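(* Let $0\le a\le m$ and $0\le b\le n$ be integers. All circuits of the bipartite rigidity matroid $\mathcal{B}_{m,n}(a,b)$ are Laman circuits if and only if at least one of the following holds: (1) $a\le 1$; (2) $b\le 1$; (3) $m-a\le 2$; (4) $n-b\le 2$.
   Context: Write $[n]=\{1,\dots,n\}$. For $0\le a\le m$, $0\le b\le n$, the bipartite rigidity matroid $\mathcal{B}_{m,n}(a,b)$ is the matroid on $[m]\times[n]$ given as the column matroid of the following $(an+bm)\times mn$ matrix over $\mathbb{C}(x_{ij},y_{k\ell})_{(i,j)\in[m]\times[a],\,(k,\ell)\in[n]\times[b]}$. Columns are labeled by $[m]\times[n]$; rows are labeled by elements of $[a]\times[n]$ or of $[b]\times[m]$. The row labeled $(j,k)\in[a]\times[n]$ has $x_{ij}$ in the column $(i,k)$ for each $i\in[m]$ and $0$ in every other column. The row labeled $(\ell,i)\in[b]\times[m]$ has $y_{q\ell}$ in the column $(i,q)$ for each $q\in[n]$ and $0$ in every other column. A circuit (minimal dependent set) $C$ of $\mathcal{B}_{m,n}(a,b)$ is a Laman circuit if there are $S\subseteq[m]$ and $T\subseteq[n]$ such that $C\subseteq S\times T$ and $|C|>|T|a+|S|b-ab$. *)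

(* Defs.v *)
From HB Require Import structures.
From mathcomp Require Import all_boot all_order all_algebra.
From mathcomp Require Import complex reals.
From mathcomp Require Import mpoly.

Set Implicit Arguments.
Unset Strict Implicit.
Unset Printing Implicit Defensive.

Import GRing.Theory Num.Theory.
Local Open Scope ring_scope.

(* [R[i]] is the field of complex numbers, [R] being a model of the reals. *)

(* Labels of the indeterminates: [inl (i, j)] is that of x_(i,j) and
   [inr (k, l)] that of y_(k,l). *)
Definition var_label (m n a b : nat) : finType :=
  ('I_m * 'I_a + 'I_n * 'I_b)%type.

Definition generic_field (R : realType) (m n a b : nat) : fieldType :=
  {fraction {mpoly R[i][#|var_label m n a b|]}}.

Definition generic_var (R : realType) (m n a b : nat)
    (v : var_label m n a b) : generic_field R m n a b :=
  tofrac ('X_(enum_rank v) : {mpoly R[i][#|var_label m n a b|]}).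

Definition xvar (R : realType) (m n a b : nat) (i : 'I_m) (j : 'I_a) :
    generic_field R m n a b :=
  generic_var R (inl (i, j) : var_label m n a b).

Definition yvar (R : realType) (m n a b : nat) (k : 'I_n) (l : 'I_b) :
    generic_field R m n a b :=
  generic_var R (inr (k, l) : var_label m n a b).

Definition row_label (m n a b : nat) : finType :=
  ('I_a * 'I_n + 'I_b * 'I_m)%type.

Definition rigidity_entry (R : realType) (m n a b : nat)
    (r : row_label m n a b) (e : 'I_m * 'I_n) : generic_field R m n a b :=
  match r with
  | inl (j, k) => if e.2 == k then xvar R n b e.1 j else 0
  | inr (l, i) => if e.1 == i then yvar R m a e.2 l else 0
  end.

Definition rigidity_mx (R : realType) (m n a b : nat) :
    'M[generic_field R m n a b]_(#|row_label m n a b|, #|{: 'I_m * 'I_n}|) :=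
  \matrix_(r, c) rigidity_entry R (enum_val r) (enum_val c).

(* Independence in the column matroid concerns the family of columns indexed
   by C: equal columns at distinct labels are dependent. *)
Definition rigidity_indep (R : realType) (m n a b : nat)
    (C : {set 'I_m * 'I_n}) : bool :=
  free [seq col (enum_rank e) (rigidity_mx R m n a b) | e <- enum C].

Definition rigidity_circuit (R : realType) (m n a b : nat)
    (C : {set 'I_m * 'I_n}) : bool :=
  minset (fun D : {set 'I_m * 'I_n} => ~~ rigidity_indep R a b D) C.

(* The bound is an integer, since it may be negative. *)
Definition Laman_circuit (R : realType) (m n a b : nat)
    (C : {set 'I_m * 'I_n}) : Prop :=
  rigidity_circuit R a b C /\
  exists (S : {set 'I_m}) (T : {set 'I_n}),
    C \subset setX S T /\
    (#|C|%:Z > #|T|%:Z * a%:Z + #|S|%:Z * b%:Z - a%:Z * b%:Z).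

(* Main.v *)
(* A set C is dependent iff it contains the support of a stress, i.e. a nonzero
   matrix M with X^T M = 0 and M Y = 0; circuits are the minimal supports.

   Let M be a stress with support a circuit C, S and T its sets of nonzero rows
   and columns.  Since Y is generic, M varies with Y: differentiating M Y = 0
   with respect to the entries of Y shows that every M B is of the form N Y,
   with N supported in C and X^T N = 0.  Counting dimensions,
   |C| > a|T| + b rank(M), so C is Laman as soon as rank(M) >= |S| - a.
   - a = 0: a single row of M is a stress, so |S| = 1.
   - a = 1: if v M = 0, scaling row i of M by v_i / x_i gives another stress
     supported in C, hence a multiple of M; so v is proportional to x on S.
   - m - a <= 2: the only bad case is |S| = a + 2, M = u w of rank one; then u
     can be replaced by a kernel vector of smaller support.
   The other two cases follow by transposition.

   If a, b >= 2 and m - a, n - b >= 3, take a (a+3) x (b+3) submatrix and remove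
   from it two disjoint 2 x 2 blocks and one further entry, in distinct rows and
   columns.  A combination P U - Q V of two rank-one stresses is supported in
   the remaining set, no subset of which violates the Laman count. *)
Require Import Defs.
From mathcomp Require Import all_boot all_order all_algebra.
From mathcomp Require Import complex reals.
From mathcomp Require Import zify boolp mpoly.

Set Implicit Arguments.
Unset Strict Implicit.
Unset Printing Implicit Defensive.

Import GRing.Theory.
Local Open Scope ring_scope.

(** * Supports, general position and kernel vectors *)

Definition mxsupport (F : fieldType) (m n : nat) (M : 'M[F]_(m, n)) :
  {set 'I_m * 'I_n} := [set e | M e.1 e.2 != 0].

Definition rowsupport (F : fieldType) (m n : nat) (M : 'M[F]_(m, n)) :
  {set 'I_m} := [set i | row i M != 0].

Definition colsupport (F : fieldType) (m n : nat) (M : 'M[F]_(m, n)) :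
  {set 'I_n} := [set j | col j M != 0].

(** For [a <= m], the rows of [X] represent the uniform matroid of rank [a]. *)
Definition general_position (F : fieldType) (m a : nat) (X : 'M[F]_(m, a)) :=
  forall S : {set 'I_m}, (#|S| <= a)%N ->
  row_free (rowsub (fun k : 'I_#|S| => enum_val k) X).

Definition stress (F : fieldType) (m n a b : nat)
    (X : 'M[F]_(m, a)) (Y : 'M[F]_(n, b)) (M : 'M[F]_(m, n)) : Prop :=
  X^T *m M = 0 /\ M *m Y = 0.

(* N is, up to a scalar, the derivative of M with respect to the entry (k, l)
   of Y. *)
Definition deformable (F : fieldType) (m n a b : nat)
    (X : 'M[F]_(m, a)) (Y : 'M[F]_(n, b)) : Prop :=
  forall M : 'M[F]_(m, n), stress X Y M -> forall (k : 'I_n) (l : 'I_b),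
  exists (N : 'M[F]_(m, n)) (c : F),
    [/\ c != 0, mxsupport N \subset mxsupport M,
       X^T *m N = 0 & N *m Y = c *: (M *m delta_mx k l)].

(** On the left it restricts to the rows in [S]; on the right it extends row vectors by zero outside
    [S], and its transpose restricts them to [S]. *)
Definition extension_mx (F : fieldType) (m : nat) (S : {set 'I_m}) :
  'M[F]_(#|S|, m) := rowsub (fun k : 'I_#|S| => enum_val k) 1%:M.

Lemma mul_extension_mx (F : fieldType) (m a : nat) (S : {set 'I_m})
    (X : 'M[F]_(m, a)) :
  extension_mx F S *m X = rowsub (fun k : 'I_#|S| => enum_val k) X.
Proof. by rewrite /extension_mx mul_rowsub_mx mul1mx. Qed.

Lemma extension_mx_out (F : fieldType) (p m : nat) (S : {set 'I_m})
    (w : 'M[F]_(p, #|S|)) i j :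
  j \notin S -> (w *m extension_mx F S) i j = 0.
Proof.
move=> jS; rewrite mxE big1 // => k _; rewrite !mxE.
by case: eqP => [kj|_]; [rewrite -kj enum_valP in jS | rewrite mulr0].
Qed.

Lemma extension_mxK (F : fieldType) (m : nat) (S : {set 'I_m}) :
  extension_mx F S *m (extension_mx F S)^T = 1%:M.
Proof.
apply/matrixP=> k l; rewrite mul_extension_mx !mxE.
by rewrite eq_sym (inj_eq enum_val_inj).
Qed.

Lemma extension_mx_tr (F : fieldType) (p m : nat) (S : {set 'I_m})
    (v : 'M[F]_(p, m)) :
  (forall i j, j \notin S -> v i j = 0) ->
  v *m (extension_mx F S)^T *m extension_mx F S = v.
Proof.
move=> vS; apply/matrixP=> i j; have [jS|jS] := boolP (j \in S); last first.
  by rewrite extension_mx_out // vS.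
rewrite /extension_mx trmx_mxsub trmx1 mulmx_colsub mulmx1.
rewrite mxE (bigD1 (enum_rank_in jS j)) //= big1 => [|k kj]; rewrite !mxE.
  by rewrite enum_rankK_in // eqxx mulr1 addr0.
case: eqP => [ekj|_]; last by rewrite mulr0.
by case/eqP: kj; apply: enum_val_inj; rewrite enum_rankK_in.
Qed.

(** A kernel vector is a linear relation among the rows in its support, and at most [a] rows admit
    no nontrivial one. *)
Lemma general_position_kernel (F : fieldType) (m a : nat) (X : 'M[F]_(m, a))
    (v : 'rV[F]_m) :
  general_position X -> v *m X = 0 -> v != 0 ->
  (a < #|[set i | (v 0 i != 0)%R]|)%N.
Proof.
move=> gX vX; apply: contra_neqT; rewrite -leqNgt => /gX.
set S := [set i | _]; rewrite -mul_extension_mx => Xf.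
have vS : v *m (extension_mx F S)^T *m extension_mx F S = v.
  apply: extension_mx_tr => i j; rewrite ord1 inE negbK; exact: eqP.
move: vX; rewrite -{1}vS -mulmxA => /eqP.
by rewrite mulmx_free_eq0 // => /eqP v0; rewrite -vS v0 mul0mx.
Qed.

Lemma exists_kernel_supported (F : fieldType) (m a : nat) (X : 'M[F]_(m, a))
    (S : {set 'I_m}) :
  (a < #|S|)%N ->
  exists v : 'rV[F]_m,
    [/\ v != 0, v *m X = 0 & forall i, i \notin S -> v 0 i = 0].
Proof.
move=> aS; set Z := extension_mx F S *m X.
have /rowV0Pn[w wZ w0] : kermx Z != 0.
  rewrite kermx_eq0 -row_leq_rank -ltnNge.
  exact: leq_ltn_trans (rank_leq_col _) aS.
exists (w *m extension_mx F S); split.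
- apply: contra_neq w0 => wE.
  by rewrite -[w]mulmx1 -(extension_mxK F S) mulmxA wE mul0mx.
- by rewrite -mulmxA; apply/sub_kermxP.
- by move=> i; exact: extension_mx_out.
Qed.

(** Any [a] rows chosen in [S] form an invertible block; its inverse, padded with zero columns, is
    [W]. *)
Lemma general_position_left_inverse (F : fieldType) (m a : nat)
    (X : 'M[F]_(m, a)) (S : {set 'I_m}) :
  general_position X -> (a <= #|S|)%N ->
  exists W : 'M[F]_(a, m),
    W *m X = 1%:M /\ forall i j, j \notin S -> W i j = 0.
Proof.
move=> gX /card_geqP[s [us ss sS]].
set R := [set i in s]; have cR : #|R| = a.
  by rewrite cardsE (card_uniqP us).
have /gX : (#|R| <= a)%N by rewrite cR.
rewrite -mul_extension_mx => Rf.
have /row_fullP[B BX] : row_full (extension_mx F R *m X).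
  by rewrite /row_full (eqP Rf) cR.
exists (B *m extension_mx F R); split; first by rewrite -mulmxA.
move=> i j jS; apply: extension_mx_out; rewrite inE.
by apply: contra jS => /sS.
Qed.

(** * The dimension count for the support of a stress *)

Lemma dim_vspace_injective (F : fieldType) (U W : vectType F)
    (h : {linear U -> W}) (V : {vspace W}) :
  injective h -> (forall u, h u \in V) -> (dim U <= \dim V)%N.
Proof.
move=> hI hV.
rewrite -dimvf -(limg_ker_dim (linfun h) fullv).
have /eqP-> : lker (linfun h) == 0%VS.
  by apply/lker0P => u v; rewrite !lfunE => /hI.
rewrite capv0 dimv0 add0n dimvS //.
by apply/subvP=> _ /memv_imgP[u _ ->]; rewrite lfunE.
Qed.

Lemma mem_span_support (F : fieldType) (m n : nat) (C : {set 'I_m * 'I_n})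
    (N : 'M[F]_(m, n)) :
  mxsupport N \subset C ->
  N \in <<[seq delta_mx e.1 e.2 | e <- enum C]>>%VS.
Proof.
move=> /subsetP NC; rewrite (matrix_sum_delta N).
apply: memv_suml => i _; apply: memv_suml => j _.
have [->|Nij] := eqVneq (N i j) 0; first by rewrite scale0r mem0v.
apply/memvZ/memv_span/mapP; exists (i, j) => //.
by rewrite mem_enum NC // inE.
Qed.

Lemma mxsupportS (F : fieldType) (m n : nat) (N M : 'M[F]_(m, n)) :
  (forall i j, M i j = 0 -> N i j = 0) -> mxsupport N \subset mxsupport M.
Proof.
move=> NM; apply/subsetP=> -[i j]; rewrite !inE /=.
exact: contra_neq (NM i j).
Qed.

Lemma stress_col_support (F : fieldType) (m n a b : nat)
    (X : 'M[F]_(m, a)) (Y : 'M[F]_(n, b)) (M : 'M[F]_(m, n)) (j : 'I_n) :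
  general_position X -> stress X Y M -> col j M != 0 ->
  (a < #|[set i | (M i j != 0)%R]|)%N.
Proof.
move=> gX [XM _] Mj.
have -> : [set i | M i j != 0] = [set i | (col j M)^T 0 i != 0].
  by apply/setP=> i; rewrite !inE !mxE.
apply: (general_position_kernel gX); last by rewrite trmx_eq0.
apply: trmx_inj; rewrite trmx_mul trmxK trmx0.
by rewrite colE mulmxA XM mul0mx.
Qed.

(** Rank-nullity is applied twice to the space [V] of matrices supported in [C]: to [f] on [V], then
    to [g] on the kernel [U] of [f] in [V]. The images have dimension at least [a|T|] and
    [b rank(M)], and [M] lies in the last kernel, so the inequality is strict. *)
Lemma stress_card_support (F : fieldType) (m n a b : nat)
    (X : 'M[F]_(m, a)) (Y : 'M[F]_(n, b)) (M : 'M[F]_(m, n)) :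
  general_position X -> deformable X Y -> stress X Y M -> M != 0 ->
  (#|colsupport M| * a + \rank M * b < #|mxsupport M|)%N.
Proof.
move=> gX dXY sM M0; set C := mxsupport M; set T := colsupport M.
pose V := <<[seq delta_mx e.1 e.2 : 'M[F]_(m, n) | e <- enum C]>>%VS.
have dimV : (\dim V <= #|C|)%N.
  by apply: leq_trans (dim_span _) _; rewrite size_map -cardE.
pose f := linfun (mulmx X^T : 'M[F]_(m, n) -> 'M[F]_(a, n)).
pose g := linfun (mulmxr Y : 'M[F]_(m, n) -> 'M[F]_(m, b)).
pose U := (V :&: lker f)%VS.
have dimf : (#|T| * a <= \dim (f @: V))%N.
  have -> : (#|T| * a)%N = dim 'M[F]_(a, #|T|) by rewrite dim_matrix mulnC.
  apply: (dim_vspace_injective (h := mulmxr (extension_mx F T))).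
    move=> Z1 Z2 /= eZ.
    rewrite -[Z1]mulmx1 -[Z2]mulmx1 -(extension_mxK F T) !mulmxA.
    by rewrite eZ.
  move=> Z; rewrite (matrix_sum_delta Z) linear_sum memv_suml // => l _.
  rewrite linear_sum memv_suml // => k _; rewrite linearZ memvZ //=.
  have := enum_valP k; set j := enum_val k => jT.
  have -> : delta_mx l k *m extension_mx F T = delta_mx l j.
    apply/matrixP=> l' q; rewrite mxE (bigD1 k) //= big1 => [|k' /negPf k'k].
      by rewrite !mxE eqxx andbT addr0 -[q == j]eq_sym; case: (l' == l);
        rewrite ?mul1r ?mul0r.
    by rewrite mxE k'k andbF mul0r.
  have := jT; rewrite inE => Mj.
  (* Column [j] of [M] has more than [a] nonzero entries, so a left inverse of [X] can be supported
     there; its row [l], placed in column [j], is sent by [f] to [delta_mx l j]. *)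
  have [W [WX Wo]] := general_position_left_inverse gX
    (ltnW (stress_col_support gX sM Mj)).
  apply/memv_imgP; exists (\matrix_(i, q) (W l i *+ (q == j))).
    apply/mem_span_support/mxsupportS => i q Miq; rewrite mxE.
    by case: eqP => // qj; rewrite Wo // inE -qj Miq eqxx.
  rewrite lfunE /=; apply/matrixP=> l' q; rewrite !mxE.
  have /matrixP/(_ l l') := WX; rewrite !mxE => WXl.
  case: (eqVneq q j) => [->|/negPf qj] /=; last first.
    by rewrite andbF big1 // => i _; rewrite !mxE qj mulr0.
  rewrite andbT eq_sym -WXl; apply: eq_bigr => i _.
  by rewrite !mxE eqxx mulrC.
have dimg : (\rank M * b <= \dim (g @: U))%N.
  have -> : (\rank M * b)%N = dim 'M[F]_(\rank M, b) by rewrite dim_matrix.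
  apply: (dim_vspace_injective (h := mulmx (col_base M))).
    exact: row_full_inj (col_base_full M).
  (* A right inverse [B] of the row base gives [col_base M = M *m B], so the embedded matrices are
     combinations of the [M *m delta_mx k l] supplied by deformability. *)
  move=> Z /=; have /row_freeP[B rB] := row_base_free M.
  have := congr1 (mulmx^~ B) (mulmx_base M).
  rewrite /= -mulmxA rB mulmx1 => ->; rewrite -mulmxA.
  rewrite (matrix_sum_delta (B *m Z)) mulmx_sumr memv_suml // => k _.
  rewrite mulmx_sumr memv_suml // => l _; rewrite -scalemxAr memvZ //.
  have [N [c [c0 NM XN NY]]] := dXY M sM k l.
  apply/memv_imgP; exists (c^-1 *: N).
    rewrite memvZ // memv_cap mem_span_support //=.
    by rewrite memv_ker lfunE /= XN.
  by rewrite lfunE /= -scalemxAl NY scalerA mulVf // scale1r.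
have dimk : (0 < \dim (U :&: lker g))%N.
  rewrite lt0n dimv_eq0; apply: contra_neq M0 => U0.
  have : M \in (U :&: lker g)%VS.
    case: sM => XM MY; rewrite !memv_cap !memv_ker !lfunE /= XM MY eqxx.
    by rewrite mem_span_support // eqxx.
  by rewrite U0 memv0 => /eqP.
have := limg_ker_dim f V; have := limg_ker_dim g U; rewrite -/U.
move=> eU eV; move: dimV dimf dimg dimk eU eV.
lia.
Qed.

(** * Minimal stresses: bounding the number of nonzero rows by the rank *)

Definition minimal_stress (F : fieldType) (m n a b : nat)
    (X : 'M[F]_(m, a)) (Y : 'M[F]_(n, b)) (M : 'M[F]_(m, n)) : Prop :=
  [/\ M != 0, stress X Y M & forall N, N != 0 -> stress X Y N ->
      mxsupport N \subset mxsupport M -> mxsupport M \subset mxsupport N].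

(** If nonzero, such an [N] would have strictly smaller support than [M], since it misses the
    nonzero entries of row [i]. *)
Lemma minimal_stress_row0 (F : fieldType) (m n a b : nat)
    (X : 'M[F]_(m, a)) (Y : 'M[F]_(n, b)) (M N : 'M[F]_(m, n)) (i : 'I_m) :
  minimal_stress X Y M -> stress X Y N -> mxsupport N \subset mxsupport M ->
  row i M != 0 -> row i N = 0 -> N = 0.
Proof.
move=> [_ _ minM] sN NM /rV0Pn[j Mij] Ni0; apply/eqP/negPn/negP=> N0.
have /subsetP/(_ (i, j)) := minM N N0 sN NM; rewrite !inE /=.
move: Mij; rewrite mxE => -> /(_ isT)/eqP[].
by have /rowP/(_ j) := Ni0; rewrite !mxE.
Qed.

Lemma exists_rowsupport (F : fieldType) (m n : nat) (M : 'M[F]_(m, n)) :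
  M != 0 -> exists i, i \in rowsupport M.
Proof.
move=> M0; apply/existsP; apply: contraNT M0 => /existsPn Mi.
apply/eqP/row_matrixP => i; have := Mi i.
by rewrite inE negbK row0 => /eqP.
Qed.

(** As [X] has no columns, each row of [M] taken alone is still a stress, so minimality leaves room
    for only one nonzero row. *)
Lemma minimal_stress_rank0 (F : fieldType) (m n b : nat)
    (X : 'M[F]_(m, 0)) (Y : 'M[F]_(n, b)) (M : 'M[F]_(m, n)) :
  minimal_stress X Y M -> (#|rowsupport M| <= \rank M)%N.
Proof.
move=> mM; have [M0 [_ MY] _] := mM.
apply: (@leq_trans 1); last by rewrite lt0n mxrank_eq0.
apply/card_le1_eqP => i i'; rewrite !inE => Mi Mi'.
apply/eqP; apply: contraNT Mi => ii'.
have N0 : delta_mx i i *m M = 0.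
  apply: (minimal_stress_row0 (i := i') mM) => //.
  - by split; [rewrite [LHS]flatmx0 | rewrite -mulmxA MY mulmx0].
  - apply: mxsupportS => k j Mkj; rewrite mxE big1 // => q _; rewrite mxE.
    case: eqP => [<-|_]; last by rewrite mul0r.
    by case: eqP => [->|_]; [rewrite Mkj mulr0 | rewrite mul0r].
  - rewrite rowE mulmxA mul_delta_mx_0 ?mul0mx //.
by rewrite rowE -(mul_delta_mx i) -mulmxA N0 mulmx0.
Qed.

(** It suffices that the left kernel of [M] restricted to [S] is at most a line; it is shown to lie
    in the line spanned by [X] restricted to [S]. *)
Lemma minimal_stress_rank1 (F : fieldType) (m n b : nat)
    (X : 'M[F]_(m, 1)) (Y : 'M[F]_(n, b)) (M : 'M[F]_(m, n)) :
  general_position X -> minimal_stress X Y M ->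
  (#|rowsupport M| <= 1 + \rank M)%N.
Proof.
move=> gX mM; have [M0 [XM MY] _] := mM; set S := rowsupport M.
have x0 i : X i 0 != 0.
  have [|W [WX Wo]] := general_position_left_inverse (S := [set i]) gX.
    by rewrite cards1.
  apply/negP => /eqP Xi; have /matrixP/(_ 0 0) := WX.
  rewrite !mxE (bigD1 i) //= Xi mulr0 add0r big1 => [/eqP|k ki].
    by rewrite eq_sym oner_eq0.
  by rewrite Wo ?mul0r // inE.
have [i0 Si0] := exists_rowsupport M0.
pose Z := extension_mx F S *m M.
suff kZ : (\rank (kermx Z) <= 1)%N.
  have /mxrankS : (Z <= M)%MS by exact: submxMl.
  by move: kZ; rewrite mxrank_ker; lia.
suff /mxrankS/leq_trans : (kermx Z <= (extension_mx F S *m X)^T)%MS.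
  by apply; exact: rank_leq_row.
apply/row_subP => k; set w := row k _.
have wZ : w *m Z = 0 by apply/sub_kermxP; exact: row_sub.
have [v vE] : exists v, v = w *m extension_mx F S by eexists.
have vM : v *m M = 0 by rewrite vE -mulmxA.
(* With this rescaling [X^T *m (D *m M)] equals [v *m M], which is zero. *)
pose D := diag_mx (\row_i (v 0 i / X i 0)).
have DM i j : (D *m M) i j = v 0 i / X i 0 * M i j by rewrite mul_diag_mx !mxE.
(* The scalar for which row [i0] of [D *m M - c *: M] vanishes. *)
pose c := v 0 i0 / X i0 0.
have DMc : D *m M - c *: M = 0.
  apply: (minimal_stress_row0 (i := i0) mM); last 1 first.
  - by apply/rowP=> j; rewrite mxE mxE DM !mxE subrr.
  - split; last by rewrite mulmxBl -mulmxA -scalemxAl MY mulmx0 scaler0 subrr.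
    rewrite mulmxBr -scalemxAr XM scaler0 subr0.
    apply/matrixP => q j; rewrite ord1.
    have /matrixP/(_ 0 j) := vM; rewrite !mxE => vMj.
    rewrite -[RHS]vMj; apply: eq_bigr => i _.
    rewrite DM mxE mulrA; congr (_ * _).
    by rewrite mulrC divfK.
  - by apply: mxsupportS => i j Mij; rewrite mxE DM !mxE Mij !mulr0 subrr.
  - by rewrite inE in Si0.
have vc i : i \in S -> v 0 i = c * X i 0.
  rewrite inE => /rV0Pn[j]; rewrite mxE => Mij.
  have /matrixP/(_ i j) := DMc.
  rewrite mxE DM !mxE => /eqP; rewrite subr_eq0 => /eqP/(mulIf Mij) <-.
  by rewrite divfK.
apply/sub_rVP; exists c; apply/rowP=> q.
rewrite -[w]mulmx1 -(extension_mxK F S) mulmxA -vE.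
rewrite mul_extension_mx /extension_mx trmx_mxsub trmx1 mulmx_colsub mulmx1.
by rewrite !mxE vc // enum_valP.
Qed.

(** Rank at least two is settled by [|S| <= m <= a + 2], so only rank one needs an argument. *)
Lemma minimal_stress_rank2 (F : fieldType) (m n a b : nat)
    (X : 'M[F]_(m, a)) (Y : 'M[F]_(n, b)) (M : 'M[F]_(m, n)) :
  minimal_stress X Y M -> (m <= a + 2)%N ->
  (#|rowsupport M| <= a + \rank M)%N.
Proof.
move=> mM ma; have [M0 [XM MY] _] := mM; set S := rowsupport M.
have Sm : (#|S| <= m)%N by rewrite -[X in (_ <= X)%N]card_ord max_card.
have rM : (0 < \rank M)%N by rewrite lt0n mxrank_eq0.
have [r2|r1] := leqP 2 (\rank M); first by lia.
rewrite leqNgt; apply/negP => aS.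
have [i0 Si0] := exists_rowsupport M0.
pose w := row i0 M; have w0 : w != 0 by rewrite inE in Si0.
have Mw : (M <= w)%MS.
  rewrite -(mxrank_leqif_sup (row_sub i0 M)).
  rewrite eqn_leq mxrankS ?row_sub //=.
  by rewrite (leq_trans (n := 1)) ?lt0n ?mxrank_eq0.
(* Dropping [i0] from at least [a + 2] rows leaves enough for a kernel vector [v] vanishing at [i0];
   then [v^T *m w] is a stress inside the support of [M] with zero row [i0]. *)
have aR : (a < #|S :\ i0|)%N.
  by have := cardsD1 i0 S; rewrite Si0; lia.
have [v [v0 vX vR]] := exists_kernel_supported X aR.
have N0 : v^T *m w = 0.
  apply: (minimal_stress_row0 (i := i0) mM) => //.
  - split; first by rewrite mulmxA -trmx_mul vX trmx0 mul0mx.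
    by rewrite -mulmxA /w rowE -mulmxA MY !mulmx0.
  - apply: mxsupportS => i j Mij; rewrite mxE big_ord1 mxE.
    have [Ri|/vR->] := boolP (i \in S :\ i0); last by rewrite mul0r.
    have /sub_rVP[c Mic] := submx_trans (row_sub i M) Mw.
    have c0 : c != 0.
      move: Ri; rewrite !inE => /andP[_]; apply: contra_neq => c0.
      by rewrite Mic c0 scale0r.
    have /rowP/(_ j)/eqP := Mic.
    by rewrite !mxE Mij eq_sym mulf_eq0 (negPf c0) => /eqP->; rewrite mulr0.
  - apply/rowP => j; rewrite mxE mxE big_ord1 mxE.
    by rewrite vR ?mul0r ?mxE // !inE eqxx.
have /rV0Pn[i vi] := v0; have /rV0Pn[j wj] := w0.
have /matrixP/(_ i j)/eqP := N0.
by rewrite mxE big_ord1 mxE [RHS in _ == RHS]mxE mulf_eq0 (negPf vi) (negPf wj).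
Qed.

(** Substituting [rank(M) >= |S| - a] into the dimension count gives the Laman inequality, written
    without subtraction. *)
Lemma minimal_stress_Laman (F : fieldType) (m n a b : nat)
    (X : 'M[F]_(m, a)) (Y : 'M[F]_(n, b)) (M : 'M[F]_(m, n)) :
  general_position X -> deformable X Y -> minimal_stress X Y M ->
  (a <= 1)%N \/ (m - a <= 2)%N ->
  (#|colsupport M| * a + #|rowsupport M| * b < #|mxsupport M| + a * b)%N.
Proof.
move=> gX dXY mM am; have [M0 sM _] := mM.
have := stress_card_support gX dXY sM M0.
suff : (#|rowsupport M| <= a + \rank M)%N.
  by move=> /(leq_mul (leqnn b)); rewrite mulnDr ![(b * _)%N]mulnC; lia.
case: am => [|ma]; last by apply: (minimal_stress_rank2 mM); lia.
case: a => [|[|//]] in X gX dXY mM {sM} *.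
  by move=> _; exact: minimal_stress_rank0 mM.
by move=> _; exact: minimal_stress_rank1 mM.
Qed.

(** * Transposition, exchanging the roles of [X] and [Y] *)

Lemma stress_tr (F : fieldType) (m n a b : nat)
    (X : 'M[F]_(m, a)) (Y : 'M[F]_(n, b)) (M : 'M[F]_(m, n)) :
  stress X Y M -> stress Y X M^T.
Proof.
by move=> [XM MY]; split; apply: trmx_inj; rewrite trmx_mul !trmxK trmx0.
Qed.

Lemma mxsupport_tr (F : fieldType) (m n : nat) (M : 'M[F]_(m, n)) i j :
  ((j, i) \in mxsupport M^T) = ((i, j) \in mxsupport M).
Proof. by rewrite !inE mxE. Qed.

Lemma mxsupport_trS (F : fieldType) (m n : nat) (M N : 'M[F]_(m, n)) :
  mxsupport N^T \subset mxsupport M^T -> mxsupport N \subset mxsupport M.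
Proof.
move=> /subsetP NM; apply/subsetP => -[i j].
by rewrite -!(mxsupport_tr _ i); exact: NM.
Qed.

Lemma card_mxsupport_tr (F : fieldType) (m n : nat) (M : 'M[F]_(m, n)) :
  #|mxsupport M^T| = #|mxsupport M|.
Proof.
suff le m' n' (N : 'M[F]_(m', n')) : (#|mxsupport N^T| <= #|mxsupport N|)%N.
  by apply/eqP; rewrite eqn_leq le -{1}[M]trmxK le.
rewrite -(card_imset (mxsupport N^T) (f := fun e => (e.2, e.1))).
  apply/subset_leq_card/subsetP => _ /imsetP[[j i] + ->].
  by rewrite mxsupport_tr.
by move=> [? ?] [? ?] [-> ->].
Qed.

Lemma minimal_stress_tr (F : fieldType) (m n a b : nat)
    (X : 'M[F]_(m, a)) (Y : 'M[F]_(n, b)) (M : 'M[F]_(m, n)) :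
  minimal_stress X Y M -> minimal_stress Y X M^T.
Proof.
move=> [M0 sM minM]; split; [by rewrite trmx_eq0 | exact: stress_tr |].
move=> N N0 /stress_tr sN NM; apply: mxsupport_trS; rewrite trmxK.
by apply: minM; rewrite ?trmx_eq0 //; apply: mxsupport_trS; rewrite trmxK.
Qed.

Lemma rowsupport_tr (F : fieldType) (m n : nat) (M : 'M[F]_(m, n)) :
  rowsupport M^T = colsupport M.
Proof. by apply/setP => j; rewrite !inE -tr_col trmx_eq0. Qed.

Lemma colsupport_tr (F : fieldType) (m n : nat) (M : 'M[F]_(m, n)) :
  colsupport M^T = rowsupport M.
Proof. by rewrite -rowsupport_tr trmxK. Qed.

Lemma mxsupport_subX (F : fieldType) (m n : nat) (M : 'M[F]_(m, n)) :
  mxsupport M \subset setX (rowsupport M) (colsupport M).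
Proof.
apply/subsetP => -[i j]; rewrite !inE /= => Mij; apply/andP; split.
  by apply/rV0Pn; exists j; rewrite mxE.
by apply/cV0Pn; exists i; rewrite mxE.
Qed.

(** * Construction of a sparse stress *)

Lemma exists_kernel_exact_support (F : fieldType) (m a : nat)
    (X : 'M[F]_(m, a)) (S : {set 'I_m}) :
  general_position X -> #|S| = a.+1 ->
  exists v : 'rV[F]_m, v *m X = 0 /\ forall i, (v 0 i != 0) = (i \in S).
Proof.
move=> gX Sa.
have [|v [v0 vX vS]] := exists_kernel_supported (S := S) X; first by rewrite Sa.
(* The support lies in [S] and has at least [a + 1] elements, so it fills [S]. *)
exists v; split=> // i; have := general_position_kernel gX vX v0.
rewrite -Sa => le; set V := [set i | _] in le.
suff <- : V = S by rewrite inE.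
apply/eqP; rewrite eqEcard le andbT; apply/subsetP => k.
by rewrite inE; apply: contraR => /vS ->.
Qed.

(** [P^T *m U] vanishes on rows [i0], [i1] and columns [j2], [j3], and [Q^T *m V] on rows [i2], [i3]
    and columns [j0], [j1]. So both vanish on both removed blocks, and a combination of them can be
    made to vanish at [(i4, j4)] as well. *)
Lemma exists_sparse_stress (F : fieldType) (m n a b : nat)
    (X : 'M[F]_(m, a)) (Y : 'M[F]_(n, b)) (A : {set 'I_m}) (B : {set 'I_n})
    (i0 i1 i2 i3 i4 : 'I_m) (j0 j1 j2 j3 j4 : 'I_n) :
  general_position X -> general_position Y ->
  #|A| = (a + 3)%N -> #|B| = (b + 3)%N ->
  uniq [:: i0; i1; i2; i3; i4] -> {subset [:: i0; i1; i2; i3; i4] <= A} ->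
  uniq [:: j0; j1; j2; j3; j4] -> {subset [:: j0; j1; j2; j3; j4] <= B} ->
  exists M : 'M[F]_(m, n), [/\ M != 0, stress X Y M,
    mxsupport M \subset setX A B &
    {in [:: (i0, j0); (i0, j1); (i1, j0); (i1, j1);
            (i2, j2); (i2, j3); (i3, j2); (i3, j3); (i4, j4)],
      forall e, e \notin mxsupport M}].
Proof.
move=> gX gY cA cB ui iA uj jB.
(* Deleting two of [q + 3] indices leaves [q + 1], the size that carries a kernel vector of full
   support. *)
have circ p q (Z : 'M[F]_(p, q)) (D : {set 'I_p}) x y :
    general_position Z -> #|D| = (q + 3)%N -> x \in D -> y \in D -> x != y ->
    exists v : 'rV[F]_p, v *m Z = 0 /\
      forall i, (v 0 i != 0) = [&& i != x, i != y & i \in D].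
  move=> gZ cD Dx Dy xy.
  have [|v [vZ vD]] := exists_kernel_exact_support (S := D :\ y :\ x) gZ.
    have := cardsD1 y D; have := cardsD1 x (D :\ y).
    by rewrite cD Dy !inE xy Dx /=; lia.
  by exists v; split=> // i; rewrite vD !inE.
have [i0A i1A i2A i3A i4A] :
    [/\ i0 \in A, i1 \in A, i2 \in A, i3 \in A & i4 \in A].
  by split; apply: iA; rewrite !inE eqxx ?orbT.
have [j0B j1B j2B j3B j4B] :
    [/\ j0 \in B, j1 \in B, j2 \in B, j3 \in B & j4 \in B].
  by split; apply: jB; rewrite !inE eqxx ?orbT.
move: ui uj; rewrite /= !inE !negb_or.
move=> /and5P[/and4P[i01 i02 i03 i04] /and3P[i12 i13 i14] /andP[i23 i24] i34 _].
move=> /and5P[/and4P[j01 j02 j03 j04] /and3P[j12 j13 j14] /andP[j23 j24] j34 _].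
have [P [PX PE]] := circ _ _ X A i0 i1 gX cA i0A i1A i01.
have [Q [QX QE]] := circ _ _ X A i2 i3 gX cA i2A i3A i23.
have [U [UY UE]] := circ _ _ Y B j2 j3 gY cB j2B j3B j23.
have [V [VY VE]] := circ _ _ Y B j0 j1 gY cB j0B j1B j01.
have P0 i : (i == i0) || (i == i1) -> P 0 i = 0.
  by move=> ii; apply/eqP; rewrite -[_ == _]negbK PE andbA -negb_or ii.
have Q0 i : (i == i2) || (i == i3) -> Q 0 i = 0.
  by move=> ii; apply/eqP; rewrite -[_ == _]negbK QE andbA -negb_or ii.
have U0 j : (j == j2) || (j == j3) -> U 0 j = 0.
  by move=> jj; apply/eqP; rewrite -[_ == _]negbK UE andbA -negb_or jj.
have V0 j : (j == j0) || (j == j1) -> V 0 j = 0.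
  by move=> jj; apply/eqP; rewrite -[_ == _]negbK VE andbA -negb_or jj.
have P2 : P 0 i2 != 0 by rewrite PE eq_sym i02 eq_sym i12 i2A.
have P4 : P 0 i4 != 0 by rewrite PE eq_sym i04 eq_sym i14 i4A.
have Q4 : Q 0 i4 != 0 by rewrite QE eq_sym i24 eq_sym i34 i4A.
have U00 : U 0 j0 != 0 by rewrite UE j02 j03 j0B.
have V4 : V 0 j4 != 0 by rewrite VE eq_sym j04 eq_sym j14 j4B.
(* Each coefficient is the value of the other product at [(i4, j4)], so the two terms cancel
   there. *)
pose M := (Q 0 i4 * V 0 j4) *: (P^T *m U) - (P 0 i4 * U 0 j4) *: (Q^T *m V).
have ME i j : M i j =
    Q 0 i4 * V 0 j4 * (P 0 i * U 0 j) - P 0 i4 * U 0 j4 * (Q 0 i * V 0 j).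
  by rewrite !mxE !big_ord1 !mxE.
exists M; split.
(* At [(i2, j0)] the second product vanishes because [Q] does, and the first does not. *)
- apply/negP => /eqP/matrixP/(_ i2 j0)/eqP; rewrite ME mxE (Q0 i2) ?eqxx //.
  rewrite mul0r mulr0 subr0 !mulf_eq0.
  by rewrite (negPf P2) (negPf Q4) (negPf U00) (negPf V4).
- have XT v : v *m X = 0 -> X^T *m v^T = 0.
    by rewrite -trmx_mul => ->; rewrite trmx0.
  split.
    by rewrite mulmxBr -!scalemxAr !mulmxA !XT // !mul0mx !scaler0 subrr.
  by rewrite mulmxBl -!scalemxAl -!mulmxA UY VY !mulmx0 !scaler0 subrr.
- apply/subsetP=> -[i j]; rewrite !inE /= ME; apply: contraR.
  rewrite negb_and => /orP[iA'|jB'].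
  + have [-> ->] : P 0 i = 0 /\ Q 0 i = 0.
      by split; apply/eqP; rewrite -[_ == _]negbK ?PE ?QE (negPf iA') !andbF.
    by rewrite !(mul0r, mulr0) subrr.
  + have [-> ->] : U 0 j = 0 /\ V 0 j = 0.
      by split; apply/eqP; rewrite -[_ == _]negbK ?UE ?VE (negPf jB') !andbF.
    by rewrite !(mul0r, mulr0) subrr.
- move=> e eH; rewrite inE negbK ME; move: eH; rewrite !inE.
  do ?[case/orP => [/eqP->|]]; last move=> /eqP->; rewrite /=;
  rewrite ?(P0 i0, P0 i1, Q0 i2, Q0 i3, U0 j2, U0 j3, V0 j0, V0 j1)
    ?eqxx ?orbT //;
  rewrite ?(mul0r, mulr0) ?subrr //; by rewrite subr_eq0 mulrC.
Qed.

(** * Counting removed entries against the Laman bound *)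

Lemma card_add_count (T : finType) (S A : {set T}) (u : seq T) :
  uniq u -> {subset u <= A} -> S \subset A ->
  (#|S| + count [predC S] u <= #|A|)%N.
Proof.
move=> uu uA SA; rewrite -size_filter.
have /card_uniqP <- := filter_uniq [predC S] uu.
rewrite -(cardsID S A) (setIidPr SA) leq_add2l.
apply/subset_leq_card/subsetP => x.
by rewrite !inE mem_filter => /andP[/= -> /uA].
Qed.

(* The booleans tell which of the five special rows and columns are kept; the
   right-hand side counts the removed entries lying in kept rows and columns. *)
Lemma grid_count (x0 x1 x2 x3 x4 y0 y1 y2 y3 y4 : bool) :
  ((x0 + x1 + x2 + x3 + x4 - 2) * (y0 + y1 + y2 + y3 + y4 - 2) <=
   (x0 + x1) * (y0 + y1) + (x2 + x3) * (y2 + y3) + x4 * y4)%N.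
Proof.
by case: x0 x1 x2 x3 x4 y0 y1 y2 y3 y4 => [] [] [] [] [] [] [] [] [] [].
Qed.

(** Of five special elements, three minus the number missing is the number kept minus two. The
    nested sum is what [count] reduces to on a list of five. *)
Lemma leq_sub_count (x0 x1 x2 x3 x4 : bool) (s a : nat) :
  (s + (~~ x0 + (~~ x1 + (~~ x2 + (~~ x3 + (~~ x4 + 0))))) <= a + 3)%N ->
  (s - a <= x0 + x1 + x2 + x3 + x4 - 2)%N.
Proof. by case: x0 x1 x2 x3 x4 => [] [] [] [] [] /=; lia. Qed.

(** With [s = a + u] and [t = b + v], one has [s t - u v = t a + s b - a b]; the right-hand side is
    monotone in [s] and [t]. *)
Lemma leq_Laman_bound (a b c s t s0 t0 : nat) :
  (a < s)%N -> (b < t)%N -> (s <= s0)%N -> (t <= t0)%N ->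
  (c + (s - a) * (t - b) <= s * t)%N -> (c + a * b <= t0 * a + s0 * b)%N.
Proof.
move=> aS bT leS leT.
have [u sE] : exists u, s = (a + u)%N by exists (s - a)%N; lia.
have [v tE] : exists v, t = (b + v)%N by exists (t - b)%N; lia.
move: (leq_mul leS (leqnn b)) (leq_mul leT (leqnn a)).
rewrite sE tE !addKn !(mulnDl, mulnDr).
lia.
Qed.

(** The claim covers every nonzero stress [N] inside the support of [M], since [M] itself may fail
    to be minimal. By [grid_count], [N] misses at least [(|S| - a)(|T| - b)] cells of the rectangle
    that contains it. *)
Lemma exists_non_Laman_stress (F : fieldType) (m n a b : nat)
    (X : 'M[F]_(m, a)) (Y : 'M[F]_(n, b)) :
  general_position X -> general_position Y ->
  (2 <= a)%N -> (2 <= b)%N -> (a + 3 <= m)%N -> (b + 3 <= n)%N ->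
  exists M : 'M[F]_(m, n), [/\ M != 0, stress X Y M &
    forall N, N != 0 -> stress X Y N -> mxsupport N \subset mxsupport M ->
    forall S T, mxsupport N \subset setX S T ->
    (#|mxsupport N| + a * b <= #|T| * a + #|S| * b)%N].
Proof.
move=> gX gY a2 b2 am bn.
(* Here [2 <= q] ensures that [q + 3] indices contain five special ones. *)
have pick5 p q : (2 <= q)%N -> (q + 3 <= p)%N ->
    exists (A : {set 'I_p}) i0 i1 i2 i3 i4,
    [/\ #|A| = (q + 3)%N, uniq [:: i0; i1; i2; i3; i4] &
      {subset [:: i0; i1; i2; i3; i4] <= A}].
  move=> q2 qp; have : (q + 3 <= #|'I_p|)%N by rewrite card_ord.
  move=> /card_geqP[s [us ss _]]; exists [set i in s].
  have cs : #|[set i in s]| = (q + 3)%N by rewrite cardsE (card_uniqP us).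
  have /card_geqP[t [ut ct tA]] : (5 <= #|[set i in s]|)%N by rewrite cs; lia.
  case: t => [|i0 [|i1 [|i2 [|i3 [|i4 [|? ?]]]]]] // in ut ct tA *.
  by exists i0, i1, i2, i3, i4.
have [A [i0 [i1 [i2 [i3 [i4 [cA ui iA]]]]]]] := pick5 m a a2 am.
have [B [j0 [j1 [j2 [j3 [j4 [cB uj jB]]]]]]] := pick5 n b b2 bn.
have [M [M0 sM MAB hole]] := exists_sparse_stress gX gY cA cB ui iA uj jB.
exists M; split=> // N N0 sN NM S0 T0 NST.
(* The special indices are counted against [|A| = a + 3] and [|B| = b + 3]; shrinking [S0] and [T0]
   only strengthens the bound. *)
pose S := S0 :&: A; pose T := T0 :&: B.
have {}NST : mxsupport N \subset setX S T.
  apply/subsetP => -[i j] Nij; rewrite !inE /=.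
  have := subsetP NST _ Nij; have := subsetP MAB _ (subsetP NM _ Nij).
  by rewrite !inE => /andP[-> ->] /andP[-> ->].
have aS : (a < #|S|)%N.
  have /exists_rowsupport[j] : N^T != 0 by rewrite trmx_eq0.
  rewrite rowsupport_tr inE => Nj.
  apply: leq_trans (stress_col_support gX sN Nj) _.
  apply/subset_leq_card/subsetP => i; rewrite inE => Nij.
  by have /subsetP/(_ (i, j)) := NST; rewrite !in_setX inE => /(_ Nij)/andP[].
have bT : (b < #|T|)%N.
  have [k] := exists_rowsupport N0; rewrite -colsupport_tr inE => Nk.
  apply: leq_trans (stress_col_support gY (stress_tr sN) Nk) _.
  apply/subset_leq_card/subsetP => j; rewrite inE mxE => Nkj.
  by have /subsetP/(_ (k, j)) := NST; rewrite !in_setX inE => /(_ Nkj)/andP[].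
have leS : (#|S| <= #|S0|)%N by rewrite subset_leq_card ?subsetIl.
have leT : (#|T| <= #|T0|)%N by rewrite subset_leq_card ?subsetIl.
have cS := card_add_count ui iA (subsetIr S0 A).
have cT := card_add_count uj jB (subsetIr T0 B).
set H := (X in {in X, _}) in hole.
have uH : uniq H.
  move: ui uj; rewrite /H /= !inE !negb_or.
  move=> /and5P[/and4P[i01 i02 i03 i04] /and3P[i12 i13 i14]
    /andP[i23 i24] i34 _].
  move=> /and5P[/and4P[j01 j02 j03 j04] /and3P[j12 j13 j14]
    /andP[j23 j24] j34 _].
  by rewrite !xpair_eqE !eqxx (negPf i01) (negPf i02) (negPf i03) (negPf i04)
    (negPf i12) (negPf i13) (negPf i14) (negPf i23) (negPf i24) (negPf i34)
    (negPf j01) (negPf j23).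
(* Only removed entries inside the rectangle lower the number of cells available to [N]. *)
have HST : {subset filter (mem (setX S T)) H <= setX S T}.
  by move=> e; rewrite mem_filter => /andP[].
have := card_add_count (filter_uniq _ uH) HST NST.
have -> : count [predC mxsupport N] (filter (mem (setX S T)) H) =
          count (mem (setX S T)) H.
  rewrite -[RHS]size_filter; apply/eqP; rewrite -all_count.
  apply/allP => e; rewrite mem_filter => /andP[_ /hole].
  by apply: contra; exact: (subsetP NM).
rewrite cardsX /= !in_setX /= -!mulnb => cN.
have := grid_count (i0 \in S) (i1 \in S) (i2 \in S) (i3 \in S) (i4 \in S)
  (j0 \in T) (j1 \in T) (j2 \in T) (j3 \in T) (j4 \in T).
move: cN cS cT; rewrite /= cA cB -/S -/T.
clear -aS bT leS leT; clearbody S T.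
move: (i0 \in S) (i1 \in S) (i2 \in S) (i3 \in S) (i4 \in S)
  (j0 \in T) (j1 \in T) (j2 \in T) (j3 \in T) (j4 \in T).
move=> x0 x1 x2 x3 x4 y0 y1 y2 y3 y4.
move: #|S| #|T| #|S0| #|T0| #|mxsupport N| aS bT leS leT.
move=> s t s0 t0 c aS bT leS leT cN cS cT grid.
have sp := leq_sub_count cS; have tq := leq_sub_count cT.
have {}grid := leq_trans (leq_mul sp tq) grid.
have {cN}cN : (c + (s - a) * (t - b) <= s * t)%N.
  apply: leq_trans cN; rewrite leq_add2l; apply: leq_trans grid _.
  by rewrite !mulnDl !mulnDr -!addnA !addn0.
by apply: leq_Laman_bound aS bT leS leT _.
Qed.

(** * Denominators and derivations *)

Lemma fraction_denominator (P : idomainType) (f : {fraction P}) :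
  exists d p : P, d != 0 /\ tofrac d * f = tofrac p.
Proof.
elim/generic_quotient.quotW: f => x; exists (\d_x), (\n_x).
split; first exact: denom_ratioP.
rewrite -[_ * _]/(FracField.mul _ _) /FracField.tofrac.
unlock FracField.tofrac.
rewrite !generic_quotient.piE; apply/eqP.
rewrite FracField.equivf_def /FracField.mulf.
rewrite !numden_Ratio ?mulf_neq0 ?oner_neq0 ?denom_ratioP //.
by rewrite mulr1 mul1r mulrC.
Qed.

(** A common denominator allows derivations to act on matrices over [P] rather than on fractions. *)
Lemma matrix_denominator (P : idomainType) (m n : nat)
    (M : 'M[{fraction P}]_(m, n)) :
  exists (d : P) (N : 'M[P]_(m, n)),
    d != 0 /\ tofrac d *: M = map_mx (@tofrac P) N.
Proof.
have [d dP] : exists d : 'I_m * 'I_n -> P, forall e, d e != 0 /\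
    exists p, tofrac (d e) * M e.1 e.2 = tofrac p.
  apply: (@fin_all_exists _ (fun=> P) (fun e d => d != 0 /\
    exists p, tofrac d * M e.1 e.2 = tofrac p)) => e.
  by have [d [p [d0 pE]]] := fraction_denominator (M e.1 e.2);
     exists d; split=> //; exists p.
have [p pE] : exists p : 'I_m * 'I_n -> P, forall e,
    tofrac (d e) * M e.1 e.2 = tofrac (p e).
  by apply: (@fin_all_exists _ (fun=> P) (fun e p =>
    tofrac (d e) * M e.1 e.2 = tofrac p)) => e; case: (dP e).
exists (\prod_e d e).
exists (\matrix_(i, j) ((\prod_(e | e != (i, j)) d e) * p (i, j))).
split; first by apply/prodf_neq0 => e _; case: (dP e).
apply/matrixP => i j; rewrite !mxE (bigD1 (i, j)) //= !tofracM -pE /=.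
by rewrite mulrAC mulrC.
Qed.

Definition is_derivation (P : nzRingType) (D : {additive P -> P}) :=
  forall p q, D (p * q) = D p * q + p * D q.

Lemma derivation_mulmx (P : nzRingType) (D : {additive P -> P})
    (m n p : nat) (A : 'M[P]_(m, n)) (B : 'M[P]_(n, p)) :
  is_derivation D ->
  map_mx D (A *m B) = map_mx D A *m B + A *m map_mx D B.
Proof.
move=> DM; apply/matrixP => i j; rewrite !mxE raddf_sum -big_split /=.
by apply: eq_bigr => k _; rewrite DM !mxE.
Qed.

(** For [N = d M] over [P], differentiating [X^T N = 0] and [N Y = 0] gives [X^T D(N) = 0] and
    [D(N) Y = - N delta_mx k l], whence the scalar [- d]. The support does not grow, as [D] sends
    zero entries to zero. *)
Lemma deformable_fraction (P : idomainType) (m n a b : nat)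
    (X : 'M[P]_(m, a)) (Y : 'M[P]_(n, b)) :
  (forall k l, exists D : {additive P -> P}, [/\ is_derivation D,
     map_mx D X = 0 & map_mx D Y = delta_mx k l]) ->
  deformable (map_mx (@tofrac P) X) (map_mx (@tofrac P) Y).
Proof.
move=> exD M [XM MY] k l; have [D [DM DX DY]] := exD k l.
have [d [N [d0 NE]]] := matrix_denominator M.
have tofrac_inj m' n' : injective (map_mx (@tofrac P) : 'M_(m', n') -> _).
  move=> A B /matrixP eAB; apply/matrixP => i j; apply/eqP.
  by have := eAB i j; rewrite !mxE => /eqP; rewrite tofrac_eq.
have XN : X^T *m N = 0.
  apply: tofrac_inj; rewrite map_mxM -map_trmx -NE -scalemxAr XM scaler0.
  by rewrite map_mx0.
have NY : N *m Y = 0.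
  by apply: tofrac_inj; rewrite map_mxM -NE -scalemxAl MY scaler0 map_mx0.
have DN0 i j : N i j = 0 -> D (N i j) = 0 by move=> ->; rewrite raddf0.
exists (map_mx (@tofrac P) (map_mx D N)), (- tofrac d); split.
- by rewrite oppr_eq0 tofrac_eq0.
- apply: mxsupportS => i j Mij; rewrite !mxE DN0 ?tofrac0 //.
  have /matrixP/(_ i j) := NE; rewrite !mxE Mij mulr0 => /eqP.
  by rewrite eq_sym tofrac_eq0 => /eqP.
- have := congr1 (map_mx D) XN; rewrite derivation_mulmx // -map_trmx DX trmx0.
  rewrite mul0mx add0r map_mx0 => XDN.
  by rewrite map_trmx -map_mxM XDN map_mx0.
- have := congr1 (map_mx D) NY; rewrite derivation_mulmx // DY map_mx0.
  move=> /eqP; rewrite addr_eq0 => /eqP DNY.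
  rewrite -map_mxM DNY map_mxN map_mxM map_delta_mx -NE.
  by rewrite -scalemxAl scaleNr.
Qed.

(** * Matrices of distinct indeterminates *)

Lemma mpoly_general_position (K : fieldType) (N m a : nat)
    (idx : 'I_m -> 'I_a -> 'I_N) :
  (a <= m)%N ->
  (forall i j i' j', idx i j = idx i' j' -> i = i' /\ j = j') ->
  general_position (\matrix_(i, j) tofrac ('X_(idx i j) : {mpoly K[N]})).
Proof.
move=> am idxI S Sa.
pose f (k : 'I_#|S|) : 'I_m := enum_val k.
pose g : 'I_#|S| -> 'I_a := widen_ord Sa.
(* Independence of the rows in [S] is already visible on the first [|S|] columns, where the block is
   square and its determinant specializes to 1. *)
pose Z := \matrix_(k, l) ('X_(idx (f k) (g l)) : {mpoly K[N]}).
(* A specialization of the variables at which Z becomes the identity. *)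
pose pt (x : 'I_N) : K := [exists k, x == idx (f k) (g k)]%:R.
have Z1 : map_mx (meval pt) Z = 1%:M.
  apply/matrixP => k l; rewrite !mxE mevalXU /pt; congr (nat_of_bool _)%:R.
  apply/idP/idP => [/existsP[q /eqP/idxI[]]|/eqP->]; last first.
    by apply/existsP; exists l.
  move=> /enum_val_inj -> /(congr1 val) /= eq.
  by apply/eqP/val_inj.
have detZ : \det Z != 0.
  apply/negP => /eqP Z0; have := det_map_mx (meval pt) Z.
  by rewrite Z1 det1 Z0 rmorph0 => /eqP; rewrite oner_eq0.
apply: inj_row_free => v vX.
have Zu : map_mx (@tofrac _) Z \in unitmx.
  by rewrite unitmxE unitfE det_map_mx tofrac_eq0.
apply: (row_free_inj (A := map_mx (@tofrac _) Z)).
  by rewrite row_free_unit.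
rewrite mul0mx; apply/rowP => l.
have /rowP/(_ (g l)) := vX; rewrite !mxE => vXl.
by rewrite -[RHS]vXl; apply: eq_bigr => k _; rewrite !mxE.
Qed.

Lemma mderivXU (K : fieldType) (N : nat) (i j : 'I_N) :
  mderiv i ('X_j : {mpoly K[N]}) = (i == j)%:R.
Proof.
rewrite mderivX mnm1E eq_sym; case: eqP => [->|_]; last by rewrite scale0r.
by rewrite scale1r -{1}[U_(j)%MM]add0m addmK mpolyX0.
Qed.

(** The partial derivative in the variable [idy k l] kills [X], which shares no variable with [Y],
    and sends [Y] to [delta_mx k l]. *)
Lemma mpoly_deformable (K : fieldType) (N m n a b : nat)
    (idx : 'I_m -> 'I_a -> 'I_N) (idy : 'I_n -> 'I_b -> 'I_N) :
  (forall i j k l, idx i j != idy k l) ->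
  (forall k l k' l', idy k l = idy k' l' -> k = k' /\ l = l') ->
  deformable (\matrix_(i, j) tofrac ('X_(idx i j) : {mpoly K[N]}))
             (\matrix_(k, l) tofrac ('X_(idy k l) : {mpoly K[N]})).
Proof.
move=> idxy idyI.
have toE p q (f : 'I_p -> 'I_q -> 'I_N) :
    \matrix_(i, j) tofrac ('X_(f i j) : {mpoly K[N]}) =
    map_mx (@tofrac _) (\matrix_(i, j) ('X_(f i j) : {mpoly K[N]})).
  by apply/matrixP => i j; rewrite !mxE.
rewrite !toE; apply: deformable_fraction => k l.
exists (mderiv (idy k l)); split.
- exact: mderivM.
- apply/matrixP => i j; rewrite !mxE /= mderivXU eq_sym.
  by rewrite (negPf (idxy _ _ _ _)).
- apply/matrixP => k' l'; rewrite !mxE /= mderivXU; congr (nat_of_bool _)%:R.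
  apply/eqP/andP => [/idyI[-> ->]|[/eqP-> /eqP->]] //.
Qed.

(** * Circuits of the rigidity matroid as supports of minimal stresses *)

Section Rigidity.
Context (R : realType) (m n a b : nat).
Let F := generic_field R m n a b.
Let X : 'M[F]_(m, a) := \matrix_(i, j) xvar R n b i j.
Let Y : 'M[F]_(n, b) := \matrix_(k, l) yvar R m a k l.

Let idx (i : 'I_m) (j : 'I_a) := enum_rank (inl (i, j) : var_label m n a b).
Let idy (k : 'I_n) (l : 'I_b) := enum_rank (inr (k, l) : var_label m n a b).

Let idx_inj i j i' j' : idx i j = idx i' j' -> i = i' /\ j = j'.
Proof. by move=> /enum_rank_inj [-> ->]. Qed.

Let idy_inj k l k' l' : idy k l = idy k' l' -> k = k' /\ l = l'.
Proof. by move=> /enum_rank_inj [-> ->]. Qed.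

Let idxy i j k l : idx i j != idy k l.
Proof. by rewrite (inj_eq enum_rank_inj). Qed.

Lemma general_position_x : (a <= m)%N -> general_position X.
Proof.
by move=> am; exact (@mpoly_general_position R[i] _ _ _ idx am idx_inj).
Qed.

Lemma general_position_y : (b <= n)%N -> general_position Y.
Proof.
by move=> bn; exact (@mpoly_general_position R[i] _ _ _ idy bn idy_inj).
Qed.

Lemma deformable_xy : deformable X Y.
Proof. exact (@mpoly_deformable R[i] _ _ _ _ _ idx idy idxy idy_inj). Qed.

Lemma deformable_yx : deformable Y X.
Proof.
have idyx k l i j : idy k l != idx i j by rewrite eq_sym.
exact (@mpoly_deformable R[i] _ _ _ _ _ idy idx idyx idx_inj).
Qed.

Let column (e : 'I_m * 'I_n) := col (enum_rank e) (rigidity_mx R m n a b).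

(** In the combination of columns, the rows labeled [inl] read off [X^T *m M] and those labeled
    [inr] read off [M *m Y]. *)
Lemma stressE (C : {set 'I_m * 'I_n}) (M : 'M[F]_(m, n)) :
  mxsupport M \subset C ->
  stress X Y M <->
  \sum_(q < #|C|) M (enum_val q).1 (enum_val q).2 *: column (enum_val q) = 0.
Proof.
move=> MC.
have -> : \sum_(q < #|C|) M (enum_val q).1 (enum_val q).2 *: column (enum_val q)
          = \sum_i \sum_j M i j *: column (i, j).
  rewrite -(big_enum_val (fun e => M e.1 e.2 *: column e)) /=.
  rewrite pair_bigA /= [RHS](bigID (mem C)) /= [X in _ = _ + X]big1 ?addr0.
    by apply: eq_bigr => -[i j].
  move=> [i j] Cij; have := contra (subsetP MC (i, j)) Cij.
  by rewrite inE negbK /= => /eqP ->; rewrite scale0r.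
have rowl k l :
    (\sum_i \sum_j M i j *: column (i, j)) (enum_rank (inl (l, k))) 0 =
    (X^T *m M) l k.
  rewrite summxE mxE; apply: eq_bigr => i _.
  rewrite summxE (bigD1 k) //= big1 => [|j jk]; rewrite !mxE !enum_rankK /=.
    by rewrite eqxx addr0 mulrC.
  by rewrite (negPf jk) mulr0.
have rowr i l :
    (\sum_i \sum_j M i j *: column (i, j)) (enum_rank (inr (l, i))) 0 =
    (M *m Y) i l.
  rewrite summxE mxE (bigD1 i) //= [X in _ + X]big1 ?addr0 => [|i' ii'].
    rewrite summxE; apply: eq_bigr => j _; rewrite !mxE !enum_rankK /=.
    by rewrite eqxx.
  rewrite summxE big1 // => j _; rewrite !mxE !enum_rankK /=.
  by rewrite (negPf ii') mulr0.
split=> [[XM MY]|M0].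
  apply/matrixP => r c; rewrite ord1 -(enum_valK r).
  case: (enum_val r) => [[l k]|[l i]].
    by rewrite rowl XM !mxE.
  by rewrite rowr MY !mxE.
by split; apply/matrixP => i j; [rewrite -rowl|rewrite -rowr]; rewrite M0 !mxE.
Qed.

Lemma dependentP (C : {set 'I_m * 'I_n}) :
  ~~ rigidity_indep R a b C <->
  exists M : 'M[F]_(m, n), [/\ M != 0, stress X Y M & mxsupport M \subset C].
Proof.
have nthE (q : 'I_#|C|) :
    (map_tuple column (enum_tuple C))`_q = column (enum_val q).
  by rewrite (nth_map (enum_val q)) -?cardE //= -enum_val_nth.
have -> : rigidity_indep R a b C = free (map_tuple column (enum_tuple C)) by [].
split=> [nf|[M [M0 sM MC]]].
  apply: contrapT => noM; case/negP: nf; apply/freeP => k k0 q.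
  apply: contrapT => /eqP kq; apply: noM.
  (* The coefficients [k], extended by zero outside [C]; at most one term of the sum is nonzero. *)
  pose M : 'M[F]_(m, n) := \matrix_(i, j) \sum_p k p *+ (enum_val p == (i, j)).
  have ME p : M (enum_val p).1 (enum_val p).2 = k p.
    rewrite mxE -surjective_pairing (bigD1 p) //= eqxx big1 ?addr0 // => p' pp'.
    by rewrite (inj_eq enum_val_inj) (negPf pp').
  have MC : mxsupport M \subset C.
    apply/subsetP => -[i j]; rewrite inE mxE /=; apply: contraNT => Cij.
    apply/eqP/big1 => p _; case: eqP => // pij.
    by rewrite -pij enum_valP in Cij.
  exists M; split=> //.
    by apply: contra_neq kq => M0; rewrite -ME M0 mxE.
  apply/(stressE MC); rewrite -[RHS]k0; apply: eq_bigr => p _.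
  by rewrite ME nthE.
apply/negP => /freeP fC; case/eqP: M0.
apply/matrixP => i j; rewrite mxE; apply/eqP/negPn/negP => Mij.
have Cij : (i, j) \in C by apply: (subsetP MC); rewrite inE.
have := fC (fun q => M (enum_val q).1 (enum_val q).2).
move=> /(_ _ (enum_rank_in Cij (i, j))); rewrite enum_rankK_in //= => M0.
case/eqP: Mij; apply: M0.
under eq_bigr => q _ do rewrite nthE.
exact/(stressE MC).
Qed.

Lemma circuit_stress (C : {set 'I_m * 'I_n}) :
  rigidity_circuit R a b C ->
  exists M : 'M[F]_(m, n), minimal_stress X Y M /\ mxsupport M = C.
Proof.
move=> /minsetP[/dependentP[M [M0 sM MC]] minC].
have suppE N :
    N != 0 -> stress X Y N -> mxsupport N \subset C -> mxsupport N = C.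
  by move=> N0 sN NC; apply: minC => //; apply/dependentP; exists N.
have MEC := suppE M M0 sM MC.
exists M; split; last exact: MEC; split; [exact: M0 | exact: sM |].
by move=> N N0 sN; rewrite MEC => NC; rewrite (suppE N N0 sN NC).
Qed.

Lemma stress_circuit (M : 'M[F]_(m, n)) :
  M != 0 -> stress X Y M ->
  exists2 C : {set 'I_m * 'I_n},
    rigidity_circuit R a b C & C \subset mxsupport M.
Proof.
move=> M0 sM.
have dM : ~~ rigidity_indep R a b (mxsupport M) by apply/dependentP; exists M.
have [C cC CM] := @minset_exists _
  (fun D : {set 'I_m * 'I_n} => ~~ rigidity_indep R a b D) _ dM.
by exists C; [exact: cC | exact: CM].
Qed.

Lemma circuit_Laman (C : {set 'I_m * 'I_n}) :
  (a <= m)%N -> (b <= n)%N ->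
  [\/ (a <= 1)%N, (b <= 1)%N, (m - a <= 2)%N | (n - b <= 2)%N] ->
  rigidity_circuit R a b C -> Laman_circuit R a b C.
Proof.
move=> am bn small cC; have [M [mM MC]] := circuit_stress cC; split=> //.
exists (rowsupport M), (colsupport M).
split; first by rewrite -MC mxsupport_subX.
suff : (#|colsupport M| * a + #|rowsupport M| * b < #|C| + a * b)%N by lia.
have [smalla|smallb] :
    ((a <= 1)%N \/ (m - a <= 2)%N) \/ ((b <= 1)%N \/ (n - b <= 2)%N).
- by case: small; tauto.
- rewrite -MC.
  exact: minimal_stress_Laman (general_position_x am) deformable_xy mM smalla.
(* The conditions on [b] and [n - b] are those of the first case for [M^T]. *)
- have := minimal_stress_Laman (general_position_y bn) deformable_yx
    (minimal_stress_tr mM) smallb.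
  rewrite colsupport_tr rowsupport_tr card_mxsupport_tr MC.
  by rewrite addnC [(b * a)%N]mulnC.
Qed.

(** Any circuit inside the support of the sparse stress is itself the support of a stress, to which
    the counting bound applies. *)
Lemma exists_non_Laman_circuit :
  (1 < a)%N -> (1 < b)%N -> (2 < m - a)%N -> (2 < n - b)%N ->
  exists2 C : {set 'I_m * 'I_n},
    rigidity_circuit R a b C & ~ Laman_circuit R a b C.
Proof.
move=> a2 b2 ma nb.
have am : (a + 3 <= m)%N by lia.
have bn : (b + 3 <= n)%N by lia.
have gX : general_position X by apply: general_position_x; lia.
have gY : general_position Y by apply: general_position_y; lia.
have [M [M0 sM nL]] := exists_non_Laman_stress gX gY a2 b2 am bn.
have [C cC CM] := stress_circuit M0 sM; exists C => //.
have [N [[N0 sN _] NC]] := circuit_stress cC.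
move=> [_ [S [T [CST]]]].
have : (#|C| + a * b <= #|T| * a + #|S| * b)%N.
  by rewrite -NC; apply: nL; rewrite ?NC.
lia.
Qed.

End Rigidity.

Theorem corollary1p5 (R : realType) (m n a b : nat)
    (ham : (a <= m)%N) (hbn : (b <= n)%N) :
  (forall C : {set 'I_m * 'I_n},
      rigidity_circuit R a b C -> Laman_circuit R a b C) <->
  [\/ (a <= 1)%N, (b <= 1)%N, (m - a <= 2)%N | (n - b <= 2)%N].
Proof.
split=> [allL|small C]; last exact: circuit_Laman.
have [a1|a2] := leqP a 1; first by constructor 1.
have [b1|b2] := leqP b 1; first by constructor 2.
have [ma|ma] := leqP (m - a) 2; first by constructor 3.
have [nb|nb] := leqP (n - b) 2; first by constructor 4.
by have [C /allL] := exists_non_Laman_circuit R a2 b2 ma nb.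
Qed.
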